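(* Let $(X,\mathscr{O},\mathscr{B},\mu)$ be a topological measure space. Let \[\mathfrak{M}_{00}(X)=\big\{f\in C_b(X):\mathrm{supp}(f)\text{ has a }\mu\text{-null neighborhood in }X\big\}\] and \[\mathfrak{M}_0(X)=\big\{f\in C_b(X):\mu\big(\mathrm{coz}(f)\big)=0\big\}.\] Then: (1) $\mathfrak{M}_{00}(X)$ is an ideal in $C_b(X)$. (2) $\mathfrak{M}_0(X)$ is a closed ideal in $C_b(X)$ containing $\mathfrak{M}_{00}(X)$. (3) Let $X$ be completely regular. Then $\mathfrak{M}_{00}(X)$ is of empty hull if and only if $\mathfrak{M}_0(X)$ is of empty hull if and only if $\mu$ is locally null. (4) Let $X$ be completely regular and let $\mu$ be locally null. Then $\mathfrak{M}_{00}(X)$ is unital if and only if $\mathfrak{M}_0(X)$ is unital if and only if $\mu$ is trivial. (5) Let $X$ be normal and let $\mu$ be locally null. Then $\mathfrak{M}_{00}(X)$ and $\mathfrak{M}_0(X)$ are isometrically isomorphic to $C_{00}(Y)$ and $C_0(Y)$, respectively, for the unique (up to homeomorphism) locally compact Hausdorff space $Y$ given by \[Y=\bigcup\big\{\mathrm{int}_{\beta X}\mathrm{cl}_{\beta X}C:C\in\mathrm{Coz}(X)\text{ and }\mathrm{cl}_XC\text{ has a }\mu\text{-null neighborhood in }X\big\},\] considered as a subspace of $\beta X$. Furthermore, $X$ is dense in $Y$ (in particular $X\subseteq Y$); $\mathfrak{M}_{00}(X)$ is dense in $\mathfrak{M}_0(X)$; and $\mathfrak{M}_{00}(X)$ is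 unital if and only if $\mathfrak{M}_0(X)$ is unital if and only if $Y$ is compact.
   Context: A topological measure space is a quadruple $(X,\mathscr{O},\mathscr{B},\mu)$ where $(X,\mathscr{B},\mu)$ is a measure space ($\mathscr{B}$ the $\sigma$-algebra of measurable sets, $\mu$ the measure), $(X,\mathscr{O})$ is a topological space, and $\mathscr{O}\subseteq\mathscr{B}$. Topological notions for $X$ refer to $(X,\mathscr{O})$. A set $U$ is $\mu$-null if $U\in\mathscr{B}$ and $\mu(U)=0$. A neighborhood of a set $A$ in $X$ is a set $U\subseteq X$ with $A\subseteq\mathrm{int}_XU$. $\mu$ is locally null if every $x\in X$ has a $\mu$-null neighborhood in $X$; $\mu$ is trivial if $\mu(X)=0$. Completely regular spaces and normal spaces are taken to be Hausdorff, and $\beta X$ is the Stone–Čech compactification of $X$, containing $X$ as a dense subspace. $C_b(X)$ is the normed algebra of continuous bounded $f:X\to\mathbb{R}$ with pointwise operations and the supremum norm; $\mathrm{coz}(f)=X\setminus f^{-1}(0)$, $\mathrm{supp}(f)=\mathrm{cl}_X\mathrm{coz}(f)$, and $\mathrm{Coz}(X)$ is the set of all cozero-sets of continuous real-valued functions on $X$. $C_{00}(Y)$ is the set of continuous bounded $f:Y\to\mathbb{R}$ with compact support, and $C_0(Y)$ the set of those with $|f|^{-1}([1/n,\infty))$ compact for each positive integer $n$. ''Isometrically isomorphic'' means by an isometric algebra isomorphism. An ideal $H$ of $C_b(X)$ is of empty hull if for every $x\in X$ there is $h\in H$ with $h(x)\neq0$. An algebra is unital if it has a multiplicative unit eleme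nt. *)

(* Defs.v *)
From HB Require Import structures.
From mathcomp Require Import all_boot all_order all_algebra.
From mathcomp Require Import all_classical all_reals all_analysis.

Set Implicit Arguments.
Unset Strict Implicit.
Unset Printing Implicit Defensive.

Import Order.TTheory GRing.Theory Num.Theory.
Import numFieldNormedType.Exports.

Local Open Scope classical_set_scope.
Local Open Scope ring_scope.

Section BoundedContinuous.
Variables (R : realType) (X : topologicalType).

Definition bounded_continuous : {pred X -> R} :=
  mem [set f : X -> R | continuous f /\ bounded_fun f].

Record Cb := MkCb {
  Cb_fun :> X -> R ;
  Cb_funP : Cb_fun \in bounded_continuous }.

HB.instance Definition _ := [isSub for Cb_fun].
HB.instance Definition _ := [Choice of Cb by <:].

Lemma bounded_continuousP (f : X -> R) :
  reflect (continuous f /\ exists M : R, forall x, `|f x| <= M)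
          (f \in bounded_continuous).
Proof.
apply: (iffP idP); rewrite inE => -[cf bf]; split=> //.
  case: bf => M [Mreal bM]; exists (M + 1) => x.
  by apply: bM => //; rewrite ltrDl.
case: bf => M bM; exists M; split; first exact: num_real.
by move=> N MN x _; exact: le_trans (bM x) (ltW MN).
Qed.

Lemma bounded_continuous_subring : subring_closed bounded_continuous.
Proof.
split=> [|f g /bounded_continuousP[cf [M fM]] /bounded_continuousP[cg [N gN]]
         |f g /bounded_continuousP[cf [M fM]] /bounded_continuousP[cg [N gN]]];
  apply/bounded_continuousP; split.
- exact: cst_continuous.
- by exists 1 => x; rewrite normr1.
- by move=> x; apply: cvgB; [exact: cf|exact: cg].
- exists (M + N) => x; apply: le_trans (ler_normB _ _) _.
  exact: lerD (fM x) (gN x).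
- by move=> x; apply: cvgM; [exact: cf|exact: cg].
- by exists (M * N) => x; rewrite normrM ler_pM.
Qed.

HB.instance Definition _ :=
  GRing.isSubringClosed.Build (X -> R) bounded_continuous
    bounded_continuous_subring.
HB.instance Definition _ :=
  GRing.SubChoice_isSubComPzRing.Build (X -> R) bounded_continuous Cb
    bounded_continuous_subring.

Lemma bounded_continuous_submod : subsemimod_closed bounded_continuous.
Proof.
split; first by split; [exact: rpred0|exact: rpredD].
move=> a f /bounded_continuousP[cf [M fM]]; apply/bounded_continuousP; split.
  by move=> x; apply: cvgM; [exact: cvg_cst|exact: cf].
by exists (`|a| * M) => x; rewrite normrM ler_wpM2l.
Qed.

HB.instance Definition _ :=
  GRing.SubZmodule_isSubLmodule.Build R (X -> R) bounded_continuous Cb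
    bounded_continuous_submod.

(* With this definition the norm is 0 when X is empty: [sup set0 = 0]. *)
Definition sup_norm (f : Cb) : R := sup [set `|f x| | x in [set: X]].

Lemma sup_norm_ub (f : Cb) x : `|f x| <= sup_norm f.
Proof.
apply: ub_le_sup; last by exists x.
by have /bounded_continuousP[_ [M fM]] := Cb_funP f; exists M => _ [y _ <-].
Qed.

Lemma sup_norm_le (f : Cb) M : 0 <= M -> (forall x, `|f x| <= M) ->
  sup_norm f <= M.
Proof.
move=> M0 fM; rewrite /sup_norm.
have [->|/set0P ne] := eqVneq [set `|f x| | x in [set: X]] set0.
  by rewrite sup0.
by apply: ge_sup => // _ [x _ <-].
Qed.

Lemma sup_norm_ge0 (f : Cb) : 0 <= sup_norm f.
Proof.
have [[x]|noX] := pselect (inhabited X).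
  exact: le_trans (normr_ge0 _) (sup_norm_ub f x).
rewrite /sup_norm (_ : [set _ | _ in _] = set0) ?sup0 //.
by apply/seteqP; split=> // y [x _ _]; apply: noX; exact: inhabits x.
Qed.

Lemma sup_normD f g : sup_norm (f + g) <= sup_norm f + sup_norm g.
Proof.
apply: sup_norm_le => [|x]; first by rewrite addr_ge0 ?sup_norm_ge0.
by rewrite (le_trans (ler_normD _ _)) // lerD ?sup_norm_ub.
Qed.

Lemma sup_normZ (a : R) f : sup_norm (a *: f) = `|a| * sup_norm f.
Proof.
have le b h : sup_norm (b *: h) <= `|b| * sup_norm h.
  apply: sup_norm_le => [|x]; first by rewrite mulr_ge0 ?sup_norm_ge0.
  by rewrite normrM ler_wpM2l ?sup_norm_ub.
apply/eqP; rewrite eq_le le /=.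
have [->|a0] := eqVneq a 0; first by rewrite normr0 mul0r sup_norm_ge0.
rewrite -ler_pdivlMl ?normr_gt0 // -normfV.
by have := le a^-1 (a *: f); rewrite scalerA mulVf // scale1r.
Qed.

Lemma sup_norm_eq0 f : sup_norm f = 0 -> f = 0.
Proof.
move=> f0; apply/val_inj/funext => x; apply/eqP.
by rewrite -normr_le0 -f0 sup_norm_ub.
Qed.

HB.instance Definition _ :=
  Lmodule_isNormed.Build R Cb sup_normD sup_normZ sup_norm_eq0.

End BoundedContinuous.

Section Algebra.
Variables (R : realType) (X : topologicalType).
Implicit Types H : set (Cb R X).

(* Not necessarily proper; closure under opposites and scalars follows from
   the last clause, as [Cb R X] contains the constants. *)
Definition is_ideal H :=
  [/\ H 0, forall f g, H f -> H g -> H (f + g) &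
      forall a f, H f -> H (a * f)].

Definition of_empty_hull H := forall x : X, exists2 h, H h & h x != 0.

Definition unital H := exists2 u, H u & forall f, H f -> u * f = f /\ f * u = f.

End Algebra.

Definition isometrically_isomorphic (R : realType) (X Y : topologicalType)
    (H : set (Cb R X)) (K : set (Cb R Y)) :=
  exists phi : Cb R X -> Cb R Y,
  [/\ set_bij H K phi,
      forall f g, H f -> H g -> phi (f + g) = phi f + phi g,
      forall (a : R) f, H f -> phi (a *: f) = a *: phi f,
      forall f g, H f -> H g -> phi (f * g) = phi f * phi g &
      forall f g, H f -> H g -> `|phi f - phi g| = `|f - g|].

Section Support.
Variables (R : realType) (X : topologicalType).

Definition coz (f : X -> R) : set X := ~` (f @^-1` [set 0]).
Definition supp (f : X -> R) : set X := closure (coz f).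

Definition cozero_sets : set (set X) :=
  [set C | exists2 f : X -> R, continuous f & C = coz f].

Definition C00 : set (Cb R X) := [set f | compact (supp f)].

Definition C0 : set (Cb R X) :=
  [set f | forall n : nat, compact [set x | n.+1%:R^-1 <= `|f x|]].

End Support.

(* The measurable structures of the library are built on pointed types; the
   following predicate also covers the empty space. Values of [mu] outside of
   [B] are irrelevant. See [measure_onW] and [measure_onP] for the agreement
   with the measures of the library. *)
Record measure_on (R : realType) (X : Type) (B : set (set X))
    (mu : set X -> \bar R) : Prop := {
  measure_on_sigma_algebra : sigma_algebra [set: X] B ;
  measure_on_set0 : mu set0 = 0%E ;
  measure_on_ge0 : forall A, B A -> (0 <= mu A)%E ;
  measure_on_sigma_additive : forall F : (set X)^nat,
    (forall n, B (F n)) -> trivIset setT F ->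
    (fun n => \sum_(0 <= i < n) mu (F i))%E @ \oo --> mu (\bigcup_n F n) }.

Lemma measure_onW (R : realType) (d : measure_display) (T : measurableType d)
  (mu : {measure set T -> \bar R}) : measure_on measurable mu.
Proof.
split.
- split=> [|A mA|F mF]; first exact: measurable0.
  + by apply: measurableD mA; exact: measurableT.
  + exact: bigcupT_measurable.
- exact: measure0.
- by move=> A _; exact: measure_ge0.
- move=> F mF tF; apply: measure_semi_sigma_additive => //.
  exact: bigcupT_measurable.
Qed.

Lemma measure_onP (R : realType) (T : pointedType) (B : set (set T))
    (mu : set T -> \bar R) : measure_on B mu ->
  exists m : {measure set (g_sigma_algebraType B) -> \bar R},
    forall A, B A -> m A = mu A.
Proof.
case=> sB mu0 mu_ge0 mu_sadd.
have mE : @measurable _ (g_sigma_algebraType B) = B.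
  exact: measurable_g_measurableTypeE.
pose m (A : set (g_sigma_algebraType B)) := if A \in B then mu A else 0%E.
have mB A : B A -> m A = mu A by move=> BA; rewrite /m mem_set.
have B0 : B set0 by case: sB.
have m_set0 : m set0 = 0%E by rewrite mB.
have m_ge0 A : (0 <= m A)%E.
  by rewrite /m; case: ifPn => // /set_mem; exact: mu_ge0.
have m_sadd : semi_sigma_additive m.
  move=> F; rewrite mE => BF tF BUF; rewrite (mB _ BUF).
  under eq_fun do under eq_bigr do rewrite mB //.
  exact: mu_sadd.
pose M := isMeasure.Build _ _ _ m m_set0 m_ge0 m_sadd.
by exists (HB.pack_for {measure set (g_sigma_algebraType B) -> \bar R} m M).
Qed.

Section TopologicalMeasure.
Variables (R : realType) (X : topologicalType).
Variables (B : set (set X)) (mu : set X -> \bar R).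

Definition topological_measure := measure_on B mu /\ @open X `<=` B.

Definition null_set (U : set X) := B U /\ mu U = 0%E.

Definition neighborhood (A U : set X) := A `<=` U°.

Definition has_null_neighborhood (A : set X) :=
  exists2 U, neighborhood A U & null_set U.

Definition locally_null := forall x : X, has_null_neighborhood [set x].

Definition trivial_measure := mu [set: X] = 0%E.

Definition M00 : set (Cb R X) := [set f | has_null_neighborhood (supp f)].

Definition M0 : set (Cb R X) := [set f | mu (coz f) = 0%E].

End TopologicalMeasure.

Definition homeomorphic (X Y : topologicalType) :=
  exists (f : X -> Y) (g : Y -> X),
    [/\ continuous f, continuous g, cancel f g & cancel g f].

Definition topological_embedding (X Z : topologicalType) (e : X -> Z) :=
  injective e /\
  forall U : set X, open U <-> exists2 V : set Z, open V & e @^-1` V = U.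

Record stone_cech (X bX : topologicalType) (e : X -> bX) : Prop := {
  stone_cech_compact : compact [set: bX] ;
  stone_cech_hausdorff : hausdorff_space bX ;
  stone_cech_embedding : topological_embedding e ;
  stone_cech_dense : dense (range e) ;
  stone_cech_extension : forall K : topologicalType,
    compact [set: K] -> hausdorff_space K ->
    forall f : X -> K, continuous f ->
    exists2 g : bX -> K, continuous g & g \o e = f }.

(* The subset Y of bX, where X is identified with its image under [e]; as a
   type, its topology is the subspace topology inherited from bX. *)
Definition null_spectrum (R : realType) (X : topologicalType)
    (B : set (set X)) (mu : set X -> \bar R) (bX : topologicalType)
    (e : X -> bX) : set bX :=
  \bigcup_(C in [set C : set X | cozero_sets R C /\
                   has_null_neighborhood B mu (closure C)])
    (closure (e @` C))°.

(* Main.v *)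
Require Import Defs.
From HB Require Import structures.
From mathcomp Require Import all_boot all_order all_algebra.
From mathcomp Require Import all_classical all_reals all_analysis.
From mathcomp Require Import ring lra.

Set Implicit Arguments.
Unset Strict Implicit.
Unset Printing Implicit Defensive.

Import Order.TTheory GRing.Theory Num.Theory.
Import numFieldNormedType.Exports.

Local Open Scope classical_set_scope.
Local Open Scope ring_scope.

(** Statements (1)-(4) are bookkeeping with null sets. Open sets are
measurable, so a set has a null neighborhood exactly when it lies in a null
open set, and such sets form an ideal; countable subadditivity takes care of
limits. The bridge between the measure and the functions is a bump function
(separated_bump) that is 1 on the given set and whose whole support, not only
its cozero set, lies in a prescribed null open set. A unit of an ideal of
empty hull is the constant function 1, so the ideal is unital only if the
whole space is null.

For (5), two facts describe the compact subsets of the spectrum Y in terms of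
null sets of X.
- If A is closed in X and has a null neighborhood, then the closure of A in bX
  lies in Y (closure_null_sub_spectrum): the extension to bX of a bump
  function g that is 1 on A is nonzero on that closure, and its cozero set
  lies in the closure of coz g.
- If a compact set K lies in Y, then the trace of K on X has a null
  neighborhood (preimage_compact_null): the open sets whose union is Y form a
  directed family, hence K lies in a single one of them.

The first fact for points gives that X is contained in Y, where it is dense;
so restriction to X is an isometric isomorphism from C_b(Y) onto C_b(X), and it
is onto because bounded functions extend to bX. The two facts applied to
supports, respectively to the sets where |f| is at least a given positive
number, show that this isomorphism matches C_00(Y) with M_00 and C_0(Y) with
M_0. Applied to the whole space they show that Y is compact exactly when mu is
trivial, which by (4) is when the ideals are unital.

Uniqueness of Y depends on the algebra structure only, not on the norm, and the
argument treats both ideals at once. Let H be an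
ideal of C_b(Y) consisting of functions vanishing at infinity. Every nonzero
multiplicative linear functional on H is the evaluation at a point
(character_eval). An algebra isomorphism from H to such an ideal K of C_b(Z)
therefore transposes to a map from Z to Y, which is continuous as soon as the
cozero sets of members of H form a base of Y, and the inverse isomorphism gives
the inverse map. Urysohn functions provide the base when Y is locally compact
and Hausdorff. *)

(** * Compactness and subspaces *)

(** If no member of the family contained K, the traces on K of the complements
of the members would generate a proper filter, by directedness; a cluster
point of that filter in K lies in no member of the family. *)
Lemma compact_directed_cover (T : topologicalType) (G : set (set T)) (K : set T) :
  compact K -> G !=set0 ->
  (forall U V, G U -> G V -> exists2 W, G W & U `|` V `<=` W) ->
  (forall U, G U -> open U) -> K `<=` \bigcup_(U in G) U ->
  exists2 U, G U & K `<=` U.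
Proof.
move=> cK [U0 GU0] dirG oG KG; apply: contrapT => nG.
pose F := filter_from G (fun U => K `\` U).
have FF : Filter F.
  apply: filter_from_filter; first by exists U0.
  move=> U V GU GV; have [W GW UVW] := dirG U V GU GV; exists W => // x [Kx nWx].
  by split; split => // ?; apply: nWx; apply: UVW; [left|right].
have PF : ProperFilter F.
  apply: filter_from_proper => U GU; apply: contrapT => nKU; apply: nG.
  exists U => // x Kx; apply: contrapT => nUx; apply: nKU.
  by exists x.
have FK : F K by exists U0 => // x [].
have [p [Kp clp]] := cK F PF FK.
have [U GU Up] := KG p Kp.
have FU : F (K `\` U) by exists U.
(* U is a neighborhood of p that misses the member K \ U of the filter. *)
have [x [[_ nUx] Ux]] := clp _ _ FU (open_nbhs_nbhs (conj (oG U GU) Up)).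
exact: nUx.
Qed.

Section subspaces.
Variables (T : topologicalType) (A : set T).

Lemma set_valP_mem (y : A) : A (\val y).
Proof. by case: y => y /= /set_mem. Qed.

Lemma val_continuous : continuous (\val : A -> T).
Proof. exact: initial_continuous. Qed.

Lemma open_set_typeP (U : set A) :
  open U <-> exists2 V : set T, open V & \val @^-1` V = U.
Proof. by split=> -[V oV VU]; exists V. Qed.

(** A filter on the subspace that contains B has its image clustering at some
point of B in T, and open sets of the subspace are traces of open sets of
T. *)
Lemma compact_set_type (B : set A) : compact ((\val : A -> T) @` B) -> compact B.
Proof.
move=> cB F FF FB.
have F'B : F ((\val : A -> T) @^-1` ((\val : A -> T) @` B)).
  by apply: filterS FB => b Bb; exists b.
have [_ [[b Bb <-] clb]] := cB _ (fmap_proper_filter _ FF) F'B.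
exists b; split=> // S N FS; rewrite nbhsE => -[N' [/open_set_typeP[V oV <-] Vb] VN].
have [] := clb ((\val : A -> T) @` S) V.
- have : F ((\val : A -> T) @^-1` ((\val : A -> T) @` S)).
    by apply: filterS FS => s Ss; exists s.
  exact.
- exact: open_nbhs_nbhs.
by move=> _ [[s Ss <-] Vs]; exists s; split=> //; apply: VN.
Qed.

Lemma compact_set_type_preimage (C : set T) :
  C `<=` A -> compact C -> compact ((\val : A -> T) @^-1` C).
Proof.
move=> CA cC; apply: compact_set_type.
suff -> : (\val : A -> T) @` (\val @^-1` C) = C by [].
apply/seteqP; split=> [_ [y Cy <-] //|x Cx].
by exists (exist _ x (mem_set (CA x Cx))).
Qed.

Lemma hausdorff_set_type : hausdorff_space T -> hausdorff_space A.
Proof.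
move=> hT p q clpq; apply: val_inj; apply: hT => U V Up Vq.
have [y [Uy Vy]] := clpq _ _ (val_continuous Up) (val_continuous Vq).
by exists (\val y).
Qed.

Lemma locally_compact_open_subspace :
  hausdorff_space T -> compact [set: T] -> open A -> locally_compact [set: A].
Proof.
move=> hT cT oA y _.
have nA : nbhs (\val y) A by apply: open_nbhs_nbhs; split => //; exact: set_valP_mem.
have [W nW WA] := compact_regular hT cT (@filterT _ (nbhs (\val y)) _) nA.
rewrite withinET; exists (\val @^-1` closure W).
  have nyW : nbhs y ((\val : A -> T) @^-1` W) := val_continuous nW.
  by apply: filterS nyW => x Wx; exact: (@subset_closure _ W (\val x) Wx).
split; last first.
  by apply: preimage_closed; [move=> x _; exact: val_continuous|exact: closed_closure].
apply: compact_set_type_preimage => //.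
exact: subclosed_compact (@closed_closure _ W) cT _.
Qed.
End subspaces.

(** * Null sets and null neighborhoods *)

Section null_sets.
Variables (R : realType) (X : topologicalType).
Variables (B : set (set X)) (mu : set X -> \bar R).
Hypothesis Hmu : topological_measure B mu.

(** Countable subadditivity for null sets, transferred from bundled measures.
These live on pointed types, so a point of X is needed; a nonempty A has
one. *)
Lemma null_cover (A : set X) (F : (set X)^nat) :
  B A -> (forall n, Defs.null_set B mu (F n)) -> A `<=` \bigcup_n F n -> mu A = 0%E.
Proof.
case: Hmu => mB _ BA nF AF.
have [->|/set0P[x0 _]] := eqVneq A set0; first exact: measure_on_set0 mB.
pose T := HB.pack_for pointedType X (Choice.on X) (isPointed.Build X x0).
have [m mE] := @measure_onP R T B mu mB.
rewrite -mE //.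
have mBE : @measurable _ (g_sigma_algebraType (B : set (set T))) = B.
  by apply: measurable_g_measurableTypeE; exact: measure_on_sigma_algebra mB.
apply: measure_negligible; first by rewrite mBE.
apply: (@negligibleS _ _ _ m _ _ AF); apply: negligible_bigcup => n.
have [BF F0] := nF n; apply/negligibleP; first by rewrite mBE.
by rewrite -F0; exact: mE.
Qed.

Lemma null_subset (A N : set X) : B A -> Defs.null_set B mu N -> A `<=` N -> mu A = 0%E.
Proof. by move=> BA nN AN; apply: (@null_cover _ (fun=> N)) => // x /AN; exists 0%N. Qed.

Lemma open_null_subset (A N : set X) :
  open A -> Defs.null_set B mu N -> A `<=` N -> mu A = 0%E.
Proof. by move=> oA; apply: null_subset; apply: (proj2 Hmu). Qed.

(** Open sets are measurable, so the interior of a null set is again null; this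
form spares checking the measurability of unions of neighborhoods. *)
Lemma has_null_neighborhoodP (A : set X) :
  has_null_neighborhood B mu A <-> exists U, [/\ open U, A `<=` U & mu U = 0%E].
Proof.
split=> [[U AU nU]|[U [oU AU U0]]].
  exists U°; split; [exact: open_interior|exact: AU|].
  by apply: open_null_subset nU _; [exact: open_interior|exact: interior_subset].
exists U; first by rewrite /neighborhood (proj1 (interior_id U) oU).
by split => //; apply: (proj2 Hmu).
Qed.

Lemma has_null_neighborhoodS (A A' : set X) : A `<=` A' ->
  has_null_neighborhood B mu A' -> has_null_neighborhood B mu A.
Proof. by move=> AA' [U AU nU]; exists U => // x /AA'/AU. Qed.

Lemma has_null_neighborhoodU (A A' : set X) :
  has_null_neighborhood B mu A -> has_null_neighborhood B mu A' ->
  has_null_neighborhood B mu (A `|` A').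
Proof.
move=> /has_null_neighborhoodP[U [oU AU U0]] /has_null_neighborhoodP[V [oV AV V0]].
apply/has_null_neighborhoodP; exists (U `|` V); split; first exact: openU.
  by move=> x [/AU|/AV]; [left|right].
(* The binary union is that of the sequence U, V, V, V, and so on. *)
apply: (@null_cover _ (fun n => if n is 0%N then U else V)).
- by apply: (proj2 Hmu); exact: openU.
- by case=> [|n]; split => //; apply: (proj2 Hmu).
- by move=> x [Ux|Vx]; [exists 0%N|exists 1%N].
Qed.

Lemma has_null_neighborhood0 : has_null_neighborhood B mu set0.
Proof.
apply/has_null_neighborhoodP; exists set0; split => //; first exact: open0.
exact: measure_on_set0 (proj1 Hmu).
Qed.

End null_sets.

(** * Bounded continuous functions *)

Section bounded_continuous_functions.
Variables (R : realType) (X : topologicalType).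
Implicit Types f g : Cb R X.

Lemma Cb_continuous f : continuous f.
Proof. by have /bounded_continuousP[] := Cb_funP f. Qed.

Lemma Cb_ext f g : (forall x, f x = g x) -> f = g.
Proof. by move=> fg; apply/val_inj/funext. Qed.

(** Pointwise values of the ring operations, to be used as a rewrite rule:
simplification would also unfold the operations that are to be kept. *)
Lemma Cb_evalE :
  ((forall f g x, ((f + g) x = f x + g x)%R) * (forall f x, ((- f) x = - f x)%R) *
   (forall f g x, ((f * g) x = f x * g x)%R) *
   (forall (c : R) f x, ((c *: f) x = c * f x)%R) *
   (forall x, (0 : Cb R X) x = 0%R) * (forall x, (1 : Cb R X) x = 1%R))%type.
Proof. by []. Qed.

Lemma exists_Cb (u : X -> R) (M : R) : continuous u -> (forall x, `|u x| <= M) ->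
  exists f, forall x, f x = u x.
Proof.
move=> cu uM; have uP : u \in @bounded_continuous R X.
  by apply/bounded_continuousP; split => //; exists M.
by exists (MkCb uP).
Qed.

Lemma Cb_normr f : exists g, forall x, g x = `|f x|.
Proof.
apply: (@exists_Cb _ `|f|); first by move=> x; apply: cvg_norm; exact: Cb_continuous.
by move=> x; rewrite normr_id; exact: sup_norm_ub.
Qed.

Lemma Cb_unit f c : 0 < c -> (forall x, c <= f x) ->
  exists g, forall x, g x = (f x)^-1.
Proof.
move=> c0 cf; have f0 x : 0 < f x by exact: lt_le_trans (cf x).
apply: (@exists_Cb _ c^-1) => x.
  by apply: cvgV; [rewrite gt_eqF|exact: Cb_continuous].
by rewrite ger0_norm ?invr_ge0 ?(ltW (f0 x)) // lef_pV2 // posrE.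
Qed.

Lemma open_coz (u : X -> R) : continuous u -> open (coz u).
Proof.
by move=> cu; apply: closed_openC; apply: preimage_closed.
Qed.

Lemma closed_superlevel (u : X -> R) (c : R) : continuous u -> closed [set x | c <= u x].
Proof. by move=> cu; apply: (preimage_closed (fun x _ => cu x) (@closed_ge _ c)). Qed.

Lemma cozE (u : X -> R) x : coz u x <-> u x != 0.
Proof. by split=> [nux|/eqP]; [apply/eqP|]. Qed.

Lemma cozD f g : coz (f + g) `<=` coz f `|` coz g.
Proof.
move=> x /cozE; rewrite Cb_evalE => fg.
have [f0|f0] := eqVneq (f x) 0; last by left; apply/cozE.
by right; apply/cozE; move: fg; rewrite f0 add0r.
Qed.

Lemma cozM f g : coz (f * g) `<=` coz g.
Proof. by move=> x /cozE; rewrite Cb_evalE mulf_eq0 => /norP[_ ?]; apply/cozE. Qed.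

Lemma suppD f g : supp (f + g) `<=` supp f `|` supp g.
Proof. by rewrite /supp -closureU; apply: closureS; exact: cozD. Qed.

Lemma suppM f g : supp (f * g) `<=` supp g.
Proof. by apply: closureS; exact: cozM. Qed.

Lemma coz0 : coz (0 : Cb R X) = set0.
Proof. by apply/seteqP; split => x // /cozE; rewrite Cb_evalE eqxx. Qed.

(** With u the separating function, equal to 0 on A and to 1 off U, put
h = 1/2 - u and take h + |h|. It vanishes unless h >= 0, that is u <= 1/2, and
this is a closed condition that fails off U; so even the closure of the cozero
set stays in U. *)
Lemma separated_bump (A U : set X) : uniform_separator A (~` U) ->
  exists g, (forall a, A a -> g a = 1) /\ supp g `<=` U.
Proof.
move=> /(@uniform_separatorP _ R)[u [cu u01 uA uU]].
have u1 x : `|u x| <= 1.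
  by have /u01 : range u (u x) by []; rewrite /= in_itv /= => /andP[u0 u1]; rewrite ger0_norm.
have [f fE] := exists_Cb cu u1.
pose h : Cb R X := (2^-1 *: (1 : Cb R X) : Cb R X) - f.
have [k kE] := Cb_normr h.
exists (h + k); have hE x : h x = 2^-1 - u x.
  by rewrite /h !Cb_evalE fE mulr1.
have hkE x : (h + k) x = h x + `|h x| by rewrite Cb_evalE kE.
split=> [a Aa|].
  have -> : (h + k) a = h a + `|h a| by rewrite hkE.
  have -> : h a = 2^-1.
    by rewrite hE (_ : u a = 0) ?subr0 //; apply: uA; exists a.
  by rewrite ger0_norm ?invr_ge0 // -div1r -splitr.
have sub : coz (h + k) `<=` [set x | 0 <= h x].
  move=> x /cozE; apply: contraNle => h0.
  by rewrite hkE ltr0_norm // subrr.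
apply: subset_trans (closureS sub) _.
rewrite -(proj1 (closure_id _) (closed_superlevel (c := 0) (Cb_continuous (f := h)))) => x.
rewrite /mkset hE => u2; apply: contrapT => nUx.
have ux : u x = 1 by apply: uU; exists x.
by move: u2; rewrite ux subr_ge0 leNgt invf_lt1 ?ltr1n.
Qed.

End bounded_continuous_functions.

Section ideals.
Variables (R : realType) (X : topologicalType) (H : set (Cb R X)).
Hypothesis iH : is_ideal H.

Lemma ideal0 : H 0. Proof. by case: iH. Qed.
Lemma idealD f g : H f -> H g -> H (f + g). Proof. by case: iH => _ + _; apply. Qed.
Lemma idealM a f : H f -> H (a * f). Proof. by case: iH => _ _; apply. Qed.
Lemma idealZ (c : R) f : H f -> H (c *: f).
Proof.
move=> /(idealM (c *: (1 : Cb R X))); suff -> : (c *: (1 : Cb R X)) * f = c *: f by [].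
by apply: Cb_ext => x; rewrite !Cb_evalE mulr1.
Qed.
Lemma idealB f g : H f -> H g -> H (f - g).
Proof. by move=> Hf Hg; rewrite -scaleN1r; apply: idealD => //; exact: idealZ. Qed.

End ideals.

(** * The ideals of null functions *)

Section null_ideals.
Variables (R : realType) (X : topologicalType).
Variables (B : set (set X)) (mu : set X -> \bar R).
Hypothesis Hmu : topological_measure B mu.

Lemma null_set_coz (f : Cb R X) : mu (coz f) = 0%E -> Defs.null_set B mu (coz f).
Proof. by split => //; apply: (proj2 Hmu); apply: open_coz; exact: Cb_continuous. Qed.

Lemma M00_ideal : is_ideal (M00 B mu).
Proof.
split=> [|f g nf ng|a f nf]; rewrite /M00 /mkset.
- by rewrite /supp coz0 closure0; exact: has_null_neighborhood0.
- by apply: (has_null_neighborhoodS (@suppD _ _ f g)); exact: has_null_neighborhoodU.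
- exact: has_null_neighborhoodS (@suppM _ _ a f) nf.
Qed.

Lemma M0_ideal : is_ideal (M0 mu).
Proof.
have oc (f : Cb R X) : B (coz f).
  by apply: (proj2 Hmu); apply: open_coz; exact: Cb_continuous.
split=> [|f g nf ng|a f nf]; rewrite /M0 /mkset.
- by rewrite coz0; exact: measure_on_set0 (proj1 Hmu).
- apply: (@null_cover _ _ _ _ Hmu _ (fun n => if n is 0%N then coz f else coz g)).
  + exact: oc.
  + by case=> [|n]; exact: null_set_coz.
  + by move=> x /cozD[?|?]; [exists 0%N|exists 1%N].
- by apply: (null_subset Hmu (oc _) (null_set_coz nf)); exact: cozM.
Qed.

Lemma M00_sub_M0 : M00 B mu `<=` M0 mu.
Proof.
move=> f [U fU nU]; apply: (open_null_subset Hmu _ nU).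
  by apply: open_coz; exact: Cb_continuous.
by move=> x /subset_closure/fU/interior_subset.
Qed.

Lemma closure_CbP (H : set (Cb R X)) (f : Cb R X) :
  closure H f <-> forall e : R, 0 < e -> exists2 g, H g & `|f - g| < e.
Proof.
split=> [clf e e0|clf N /nbhs_ballP[e /= e0 eN]].
  have [g [Hg fg]] := clf _ (nbhsx_ballx f e e0).
  by exists g => //; move: fg; rewrite -ball_normE.
have [g Hg fg] := clf e e0; exists g; split => //; apply: eN.
by rewrite -ball_normE.
Qed.

(** If |f x| > 1/(n+1) and g is within 1/(n+1) of f, then g x is nonzero; so coz f
is covered by the cozero sets of a sequence of null functions tending to f. *)
Lemma M0_closed : closed (M0 mu).
Proof.
move=> f /closure_CbP clf.
have /choice[g gP] (n : nat) : exists g : Cb R X, mu (coz g) = 0%E /\ `|f - g| < n.+1%:R^-1.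
  by have [|g] := clf n.+1%:R^-1; [rewrite invr_gt0|exists g].
apply: (@null_cover _ _ _ _ Hmu _ (fun n => coz (g n))).
- by apply: (proj2 Hmu); apply: open_coz; exact: Cb_continuous.
- by move=> n; apply: null_set_coz; case: (gP n).
- move=> x /cozE fx; have /ltr_add_invr[n] : 0 < `|f x| by rewrite normr_gt0.
  rewrite add0r => nf; exists n => //; apply/cozE; apply: contraTneq nf => gx.
  rewrite -leNgt -[f x]subr0 -gx; apply: le_trans (sup_norm_ub (f - g n) x) _.
  by apply: ltW; case: (gP n).
Qed.

(** Soft thresholding: f + (|f - d| - |f + d|) / 2 moves f towards 0 by at most d,
and vanishes where |f| <= d. Its support lies in the closed set where
|f| >= d, hence in the null open set coz f. *)
Lemma M0_sub_closure_M00 : M0 mu `<=` closure (M00 B mu).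
Proof.
move=> f nf; apply/closure_CbP => e e0.
pose d : R := e / 2; have d0 : 0 < d by rewrite divr_gt0.
have [p pE] := Cb_normr (f - (d *: (1 : Cb R X) : Cb R X)).
have [q qE] := Cb_normr (f + (d *: (1 : Cb R X) : Cb R X)).
have {}pE x : p x = `|f x - d| by rewrite pE !Cb_evalE mulr1.
have {}qE x : q x = `|f x + d| by rewrite qE !Cb_evalE mulr1.
pose g : Cb R X := f + 2^-1 *: (p - q).
have gE x : g x = f x + 2^-1 * (`|f x - d| - `|f x + d|) by rewrite -pE -qE.
exists g; last first.
  apply: (@le_lt_trans _ _ d); last by rewrite ltr_pdivrMr // ltr_pMr // ltr1n.
  apply: sup_norm_le => [|x]; first exact: ltW.
  have -> : (f - g) x = f x - g x by [].
  rewrite gE ler_norml.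
  have := lerB_normD (f x) d; have := ler_norm (f x).
  by case: (ler0P (f x - d)); case: (ler0P (f x + d)); lra.
have sub : coz g `<=` [set x | d <= `|f x|].
  move=> x /cozE; apply: contraNle; rewrite lter_norml => /andP[fd1 fd2].
  rewrite gE (ltr0_norm (x := f x - d)) ?subr_lt0 // gtr0_norm; last by lra.
  by apply/eqP; lra.
rewrite /M00 /=; apply: (has_null_neighborhoodS (A' := coz f)); last first.
  exists (coz f); last exact: null_set_coz.
  by rewrite /neighborhood (proj1 (interior_id _)) //; apply: open_coz; exact: Cb_continuous.
apply: subset_trans (closureS sub) _.
have cf : continuous (fun x => `|f x|).
  by move=> x; apply: cvg_norm; exact: Cb_continuous.
rewrite -(proj1 (closure_id _) (closed_superlevel (c := d) cf)) => x /= dfx.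
by apply/cozE; rewrite -normr_gt0; exact: lt_le_trans dfx.
Qed.

Lemma of_empty_hullS (H K : set (Cb R X)) : H `<=` K -> of_empty_hull H -> of_empty_hull K.
Proof. by move=> HK eH x; have [h /HK Kh hx] := eH x; exists h. Qed.

Lemma M0_empty_hull_locally_null : of_empty_hull (M0 mu) -> locally_null B mu.
Proof.
move=> eM x; have [h nh /cozE hx] := eM x.
exists (coz h); last exact: null_set_coz.
rewrite /neighborhood (proj1 (interior_id _)); last by apply: open_coz; exact: Cb_continuous.
by move=> _ ->.
Qed.

Lemma locally_null_M00_empty_hull : hausdorff_space X -> completely_regular_space X ->
  locally_null B mu -> of_empty_hull (M00 B mu).
Proof.
move=> hX crX lnull x; have /(has_null_neighborhoodP Hmu)[U [oU xU U0]] := lnull x.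
have [|g [g1 gU]] := @separated_bump R X [set x] U.
  by apply: crX; [exact: open_closedC|apply; exact: xU].
exists g; last by rewrite g1 // oner_neq0.
by apply/(has_null_neighborhoodP Hmu); exists U.
Qed.

(** At each x some member of H is nonzero, which forces the unit to be 1 there;
so the cozero set of the unit is X. *)
Lemma unital_trivial (H : set (Cb R X)) : H `<=` M0 mu -> of_empty_hull H -> unital H ->
  trivial_measure mu.
Proof.
move=> HM eH [u /HM nu uP].
suff uT : coz u = [set: X] by rewrite /trivial_measure -uT.
apply/seteqP; split=> // x _; have [h Hh hx] := eH x; apply/cozE.
have [uh _] := uP h Hh; have : (u * h) x = h x by rewrite uh.
rewrite Cb_evalE => uhx; apply: contra_neq hx => ux.
by rewrite -uhx ux mul0r.
Qed.

Lemma trivial_unital (H : set (Cb R X)) : M00 B mu `<=` H ->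
  trivial_measure mu -> unital H.
Proof.
move=> MH triv; exists 1; last by move=> f _; rewrite mulr1 mul1r.
apply: MH; apply/(has_null_neighborhoodP Hmu); exists [set: X]; split => //.
exact: openT.
Qed.

End null_ideals.

(** * Ideals of functions vanishing at infinity *)

Section vanishing_at_infinity.
Variables (R : realType) (Y : topologicalType).
Implicit Types (f g h : Cb R Y) (H : set (Cb R Y)).

Lemma Cb_normr_continuous f : continuous (fun y => `|f y|).
Proof. by move=> y; apply: cvg_norm; exact: Cb_continuous. Qed.

(** Any positive threshold can replace the values 1/(n+1): closed subsets of
compact sets are compact, and every positive number exceeds some 1/(n+1). *)
Lemma C0P f : C0 f <-> forall e : R, 0 < e -> compact [set y | e <= `|f y|].
Proof.
split=> [Cf e e0|Cf n]; last by apply: Cf; rewrite invr_gt0.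
have /ltr_add_invr[n] := e0; rewrite add0r => ne.
apply: (subclosed_compact _ (Cf n)); first exact: closed_superlevel (@Cb_normr_continuous f).
by move=> y /=; apply: le_trans; exact: ltW.
Qed.

Lemma C00_sub_C0 : @C00 R Y `<=` @C0 R Y.
Proof.
move=> f cf; apply/C0P => e e0.
apply: (subclosed_compact _ cf); first exact: closed_superlevel (@Cb_normr_continuous f).
move=> y /= efy; apply: subset_closure; apply/cozE.
by rewrite -normr_gt0; exact: lt_le_trans efy.
Qed.

Lemma C00_ideal : is_ideal (@C00 R Y).
Proof.
split=> [|f g cf cg|a f cf]; rewrite /C00 /mkset.
- by rewrite /supp coz0 closure0; exact: compact0.
- apply: (subclosed_compact (@closed_closure _ _) (compactU cf cg)).
  exact: suppD.
- exact: (subclosed_compact (@closed_closure _ _) cf) (@suppM _ _ a f).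
Qed.

Lemma C0_ideal : is_ideal (@C0 R Y).
Proof.
split=> [|f g /C0P cf /C0P cg|a f /C0P cf]; apply/C0P => e e0.
- suff -> : [set y | e <= `|(0 : Cb R Y) y|] = set0 by exact: compact0.
  by apply/seteqP; split => y //=; rewrite normr0 leNgt e0.
- have e20 : 0 < e / 2 by rewrite divr_gt0.
  apply: (subclosed_compact _ (compactU (cf _ e20) (cg _ e20))).
    exact: closed_superlevel (@Cb_normr_continuous (f + g)).
  move=> y; rewrite /setU /mkset Cb_evalE => efg; apply: contrapT => /not_orP[].
  move=> /negP; rewrite -ltNge => fe /negP; rewrite -ltNge => ge.
  have := le_lt_trans (le_trans efg (ler_normD _ _)) (ltrD fe ge).
  by rewrite -splitr ltxx.
- have M0 : 0 < `|a| + 1 by rewrite ltr_wpDl.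
  have eM0 : 0 < e / (`|a| + 1) by rewrite divr_gt0.
  apply: (subclosed_compact _ (cf _ eM0)).
    exact: closed_superlevel (@Cb_normr_continuous (a * f)).
  move=> y; rewrite /mkset Cb_evalE normrM => eaf.
  rewrite ler_pdivrMr // mulrC; apply: le_trans eaf _.
  rewrite ler_wpM2r //; apply: le_trans (sup_norm_ub a y) _.
  by rewrite lerDl.
Qed.

(** The hypotheses under which an ideal determines the space: its members
vanish at infinity, and their cozero sets form a base of the topology. Both
C_00 and C_0 qualify, so the uniqueness argument is made only once. *)
Definition regular_C0_ideal H :=
  [/\ is_ideal H, H `<=` @C0 R Y &
      forall y U, nbhs y U -> exists f, [/\ H f, f y != 0 & coz f `<=` U]].

(** A bump function supported in a compact neighborhood has compact support;
locally compact Hausdorff spaces are completely regular. *)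
Lemma C00_coz_base : hausdorff_space Y -> locally_compact [set: Y] ->
  forall (y : Y) U, nbhs y U -> exists f, [/\ @C00 R Y f, f y != 0 & coz f `<=` U].
Proof.
move=> hY lY y U nU; have := lY y I; rewrite withinET => -[K nK [cK clK]].
have crY := @locally_compact_completely_regular Y R lY hY.
have nUK : nbhs y (U `&` K) by exact: filterI.
have [|g [g1 gU]] := @separated_bump R Y [set y] (U `&` K)°.
  by apply: crY; [exact: open_closedC (open_interior _)|apply; exact: nUK].
exists g; split.
- apply: (subclosed_compact (@closed_closure _ _) cK).
  by move=> x /gU/interior_subset[].
- by rewrite g1 // oner_neq0.
- by move=> x /subset_closure/gU/interior_subset[].
Qed.

Lemma C00_regular : hausdorff_space Y -> locally_compact [set: Y] ->
  regular_C0_ideal (@C00 R Y).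
Proof.
by move=> hY lY; split; [exact: C00_ideal|exact: C00_sub_C0|exact: C00_coz_base].
Qed.

Lemma C0_regular : hausdorff_space Y -> locally_compact [set: Y] ->
  regular_C0_ideal (@C0 R Y).
Proof.
move=> hY lY; split; [exact: C0_ideal|by []|].
by move=> y U /(C00_coz_base hY lY)[f [/C00_sub_C0 ? ? ?]]; exists f.
Qed.

(** * Characters are evaluations *)

Section characters.
Variable H : set (Cb R Y).
Hypotheses (iH : is_ideal H) (HC0 : H `<=` @C0 R Y) (eH : of_empty_hull H).
Variable chi : Cb R Y -> R.
Hypotheses (chiD : forall f g, H f -> H g -> chi (f + g) = chi f + chi g)
  (chiZ : forall (a : R) f, H f -> chi (a *: f) = a * chi f)
  (chiM : forall f g, H f -> H g -> chi (f * g) = chi f * chi g)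
  (chi_neq0 : exists2 f, H f & chi f != 0).

Let chi0 : chi 0 = 0.
Proof. by rewrite -(scale0r (0 : Cb R Y)) chiZ ?mul0r //; exact: ideal0. Qed.

Let chiB f g : H f -> H g -> chi (f - g) = chi f - chi g.
Proof. by move=> Hf Hg; rewrite -scaleN1r chiD ?chiZ ?mulN1r //; exact: idealZ. Qed.

Let chi_eq1 : exists2 g, H g & chi g = 1.
Proof.
have [f Hf f0] := chi_neq0; exists ((chi f)^-1 *: f); first exact: idealZ.
by rewrite chiZ // mulVf.
Qed.

(** If chi f = 1 with |f| <= 1/2, then q = f / (1 - f) lies in H and
f = q - f q, so chi f = chi q - chi q = 0. This replaces the automatic
continuity of characters. *)
Let chi_neq1 f : H f -> (forall y, `|f y| <= 2^-1) -> chi f != 1.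
Proof.
move=> Hf f2; have [||v vE] := @Cb_unit R Y (1 - f) 2^-1.
- by rewrite invr_gt0.
- by move=> y; rewrite !Cb_evalE; have := f2 y; rewrite ler_norml => /andP[_]; lra.
pose q := v * f; have Hq : H q by exact: idealM.
have fq : f = q - f * q.
  apply: Cb_ext => y; rewrite !Cb_evalE vE !Cb_evalE.
  have : f y < 1 by have := f2 y; rewrite ler_norml => /andP[_]; lra.
  by move=> fy1; field; lra.
have /eqP := chiB Hq (idealM iH f Hq).
rewrite -fq chiM // => /eqP chif; apply/eqP => chif1.
by move: chif; rewrite chif1 mul1r subrr; apply/eqP; rewrite oner_eq0.
Qed.

(** Otherwise every point of Y has a member of ker chi that is nonzero there. Take
g with chi g = 1. Squares, scalings and sums give a nonnegative h in ker chi
larger than M on the compact set where |g| >= 1/2. Then g / (1 + h) is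
g - h (g / (1 + h)), so that chi takes the value 1 on it, while it is at most
1/2 in absolute value everywhere, contradicting chi_neq1. *)
Let ker_eval : exists y, forall f, H f -> chi f = 0 -> f y = 0.
Proof.
apply: contrapT => nker; have [g Hg g1] := chi_eq1.
pose pos_ker h := [/\ H h, chi h = 0 & forall y, 0 <= h y].
(* This M makes |g| / (1 + M) at most 1/2. *)
pose M := 2 * `|g| + 1.
have M0 : 0 < M by rewrite ltr_wpDl // mulr_ge0.
pose G := [set [set y | M < h y] | h in [set h | pos_ker h]].
have oG U : G U -> open U.
  move=> [h _ <-]; rewrite (_ : [set y | M < h y] = h @^-1` [set r | M < r]) //.
  by apply: open_comp => [y _|]; [exact: Cb_continuous|exact: open_gt].
have G0 : G !=set0.
  by exists [set y | M < (0 : Cb R Y) y]; exists 0 => //; split => //; exact: ideal0.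
have dirG U V : G U -> G V -> exists2 W, G W & U `|` V `<=` W.
  move=> [h [Hh ch h0] <-] [k [Hk ck k0] <-].
  exists [set y | M < (h + k) y]; last first.
    by move=> y [My|My]; rewrite /mkset Cb_evalE; [apply: ltr_wpDr|apply: ltr_wpDl].
  exists (h + k) => //; split; first exact: idealD.
    by rewrite chiD // ch ck addr0.
  by move=> y; rewrite Cb_evalE addr_ge0.
have cK : compact [set y | 2^-1 <= `|g y|].
  by apply: (proj1 (C0P g)) (HC0 Hg) _ _; rewrite invr_gt0.
have GT : [set y | 2^-1 <= `|g y|] `<=` \bigcup_(U in G) U.
  move=> y _; have [f [Hf f0 fy]] : exists f, [/\ H f, chi f = 0 & f y != 0].
    apply: contrapT => nf; apply: nker; exists y => f Hf f0.
    by apply: contrapT => fy; apply: nf; exists f; split => //; apply/eqP.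
  have fy2 : 0 < f y * f y by rewrite -expr2 lt_def sqr_ge0 andbT sqrf_eq0.
  (* The scalar c brings the value at y of the square of f to M + 1. *)
  pose c := (M + 1) / (f y * f y).
  have c0 : 0 < c by rewrite divr_gt0 // ltr_wpDl // ltW.
  exists [set y | M < (c *: (f * f)) y]; last first.
    by rewrite /mkset !Cb_evalE divfK ?gt_eqF // ltrDl.
  exists (c *: (f * f)) => //; split.
  - by apply: idealZ => //; exact: idealM.
  - by rewrite chiZ ?chiM // ?f0 ?mulr0 //; exact: idealM.
  - by move=> x; rewrite !Cb_evalE mulr_ge0 ?(ltW c0) // -expr2 sqr_ge0.
have [_ [h [Hh ch h0] <-] gh] := compact_directed_cover cK G0 dirG oG GT.
have [||v vE] := @Cb_unit R Y (1 + h) 1; first by [].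
  by move=> y; rewrite !Cb_evalE lerDl.
pose f := g - h * (v * g).
have Hvg : H (v * g) by exact: idealM.
have Hf : H f by apply: idealB => //; exact: idealM.
suff /(chi_neq1 Hf)/eqP : forall y, `|f y| <= 2^-1.
  by case; rewrite (chiB Hg (idealM iH h Hvg)) (chiM Hh Hvg) ch mul0r subr0.
move=> y; have -> : f y = g y / (1 + h y).
  by rewrite /f !Cb_evalE vE !Cb_evalE; have := h0 y => hy; field; lra.
rewrite normrM normfV (ger0_norm (x := 1 + h y)) ?addr_ge0 //.
rewrite ler_pdivrMr ?ltr_wpDr //.
have hy := h0 y; have gy := sup_norm_ub g y.
have [gy2|/ltW gy2] := leP 2^-1 `|g y|; last by lra.
have : M < h y by exact: gh.
rewrite /M; have -> : `|g| = sup_norm g by []; lra.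
Qed.

(** The kernel of chi lies in the kernel of the evaluation at y, so the evaluation
is a multiple of chi, with factor g y where chi g = 1. Multiplicativity makes
that factor idempotent, and it is nonzero because H has empty hull. *)
Lemma character_eval : exists y, forall f, H f -> chi f = f y.
Proof.
have [y yP] := ker_eval; exists y => f Hf; have [g Hg g1] := chi_eq1.
have fE k : H k -> k y = chi k * g y.
  move=> Hk; apply: subr0_eq.
  have Hcg : H (chi k *: g) by exact: idealZ.
  have := yP _ (idealB iH Hk Hcg); rewrite !Cb_evalE; apply.
  by rewrite (chiB Hk Hcg) chiZ // g1 mulr1 subrr.
have gy0 : g y != 0.
  by have [k Hk ky] := eH y; apply: contra_neq ky => gy; rewrite fE // gy mulr0.
have : (g * g) y = 1 * g y.
  by rewrite fE ?chiM // ?g1 ?mulr1 //; exact: idealM.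
by rewrite Cb_evalE => /(mulIf gy0) gy1; rewrite fE // gy1 mulr1.
Qed.

End characters.
End vanishing_at_infinity.

Lemma regular_C0_ideal_empty_hull (R : realType) (Y : topologicalType) (H : set (Cb R Y)) :
  regular_C0_ideal H -> of_empty_hull H.
Proof. by case=> _ _ base y; have [f [Hf fy _]] := base y _ (@filterT _ (nbhs y) _); exists f. Qed.

(** * Recovering the space from the ideal *)

Section isometric_isomorphisms.
Variable R : realType.

(** The map is named, rather than quantified away as in
isometrically_isomorphic, because recovering the space uses an isomorphism
together with its inverse. *)
Definition algebra_isometry (X Y : topologicalType)
    (H : set (Cb R X)) (K : set (Cb R Y)) (phi : Cb R X -> Cb R Y) :=
  [/\ set_bij H K phi,
      forall f g, H f -> H g -> phi (f + g) = phi f + phi g,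
      forall (a : R) f, H f -> phi (a *: f) = a *: phi f,
      forall f g, H f -> H g -> phi (f * g) = phi f * phi g &
      forall f g, H f -> H g -> `|phi f - phi g| = `|f - g|].

Lemma algebra_isometry_inverse (X Y : topologicalType)
    (H : set (Cb R X)) (K : set (Cb R Y)) phi :
  is_ideal H -> algebra_isometry H K phi ->
  exists psi, [/\ algebra_isometry K H psi, forall f, H f -> psi (phi f) = f &
    forall k, K k -> phi (psi k) = k].
Proof.
move=> iH [[HK inj sur] phiD phiZ phiM phiN].
have /choice[psi psiP] k : exists f, K k -> H f /\ phi f = k.
  have [Kk|] := pselect (K k); last by exists 0.
  by have [f Hf fk] := sur k Kk; exists f.
have psi_phi f : H f -> psi (phi f) = f.
  move=> Hf; have [Hp pE] := psiP _ (HK _ Hf).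
  by apply: inj => //; exact/mem_set.
exists psi; split=> [|//|k /psiP[]//]; split.
- split.
  + by move=> k /psiP[].
  + by move=> k l /set_mem/psiP[_ {2}<-] /set_mem/psiP[_ {2}<-] ->.
  + by move=> f Hf; exists (phi f); [exact: HK|exact: psi_phi].
- move=> k l /psiP[Hk {1}<-] /psiP[Hl {1}<-].
  by rewrite -phiD // psi_phi //; exact: idealD.
- move=> a k /psiP[Hk {1}<-].
  by rewrite -phiZ // psi_phi //; exact: idealZ.
- move=> k l /psiP[Hk {1}<-] /psiP[Hl {1}<-].
  by rewrite -phiM // psi_phi //; exact: idealM.
- by move=> k l /psiP[Hk {2}<-] /psiP[Hl {2}<-]; rewrite phiN.
Qed.

Lemma isometrically_isomorphic_sym (X Y : topologicalType)
    (H : set (Cb R X)) (K : set (Cb R Y)) :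
  is_ideal H -> isometrically_isomorphic H K -> isometrically_isomorphic K H.
Proof. by move=> iH [phi /(algebra_isometry_inverse iH)[psi []]]; exists psi. Qed.

Lemma isometrically_isomorphic_trans (X Y Z : topologicalType)
    (H : set (Cb R X)) (K : set (Cb R Y)) (L : set (Cb R Z)) :
  isometrically_isomorphic H K -> isometrically_isomorphic K L ->
  isometrically_isomorphic H L.
Proof.
move=> [phi [bphi phiD phiZ phiM phiN]] [psi [bpsi psiD psiZ psiM psiN]].
have HK f : H f -> K (phi f) by case: bphi => + _ _; apply.
exists (psi \o phi); split; first exact: set_bij_comp bphi bpsi.
- by move=> f g Hf Hg; rewrite /= phiD // psiD //; exact: HK.
- by move=> a f Hf; rewrite /= phiZ // psiZ //; exact: HK.
- by move=> f g Hf Hg; rewrite /= phiM // psiM //; exact: HK.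
- by move=> f g Hf Hg; rewrite /= psiN ?phiN //; exact: HK.
Qed.

(** The evaluation at z composed with phi is a character of H, that is, the
evaluation at a point s z. The preimage under s of coz f is coz (phi f), so s
is continuous because the cozero sets of H form a base. *)
Lemma isomorphism_transpose (Y Z : topologicalType) (H : set (Cb R Y)) (K : set (Cb R Z)) phi :
  regular_C0_ideal H -> of_empty_hull K -> algebra_isometry H K phi ->
  exists2 s : Z -> Y, continuous s & forall f z, H f -> f (s z) = phi f z.
Proof.
move=> rH eK [[HK inj sur] phiD phiZ phiM _]; have [iH HC0 base] := rH.
have /choice[s sP] (z : Z) : exists y, forall f, H f -> phi f z = f y.
  apply: (@character_eval R Y H iH HC0 (regular_C0_ideal_empty_hull rH) (fun f => phi f z)).
  - by move=> f g Hf Hg; rewrite phiD.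
  - by move=> a f Hf; rewrite phiZ.
  - by move=> f g Hf Hg; rewrite phiM.
  - by have [k /sur[f Hf <-] kz] := eK z; exists f.
exists s; last by move=> f z Hf; rewrite sP.
move=> z U nU; have [f [Hf fsz fU]] := base _ _ nU.
have oc : open (coz (phi f)) by apply: open_coz; exact: Cb_continuous.
have : nbhs z (coz (phi f)).
  by apply: open_nbhs_nbhs; split=> //; apply/cozE; rewrite sP.
by apply: filterS => x /cozE; rewrite sP // => /cozE/fU.
Qed.

(** The transposes of the isomorphism and of its inverse are mutually inverse,
since the members of these ideals separate points. *)
Lemma regular_ideal_isomorphism_homeomorphic (Y Z : topologicalType)
    (H : set (Cb R Y)) (K : set (Cb R Z)) :
  hausdorff_space Y -> hausdorff_space Z ->
  regular_C0_ideal H -> regular_C0_ideal K ->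
  isometrically_isomorphic H K -> homeomorphic Y Z.
Proof.
move=> hY hZ rH rK iso; have [iH _ _] := rH.
have separates (T : topologicalType) (I : set (Cb R T)) (x y : T) :
    hausdorff_space T -> regular_C0_ideal I -> (forall f, I f -> f x = f y) -> x = y.
  move=> hT [_ _ base] fxy; apply: contrapT => xy.
  have nx : nbhs x (~` [set y]).
    apply: open_nbhs_nbhs; split => //; apply: closed_openC.
    exact: accessible_closed_set1 (hausdorff_accessible hT) y.
  have [f [If fx fC]] := base x _ nx.
  have /fC : coz f y by apply/cozE; rewrite -fxy.
  exact.
have [phi isophi] := iso.
have [psi [isopsi psiK phiK]] := algebra_isometry_inverse iH isophi.
have [s cs sP] := isomorphism_transpose rH (regular_C0_ideal_empty_hull rK) isophi.
have [t ct tP] := isomorphism_transpose rK (regular_C0_ideal_empty_hull rH) isopsi.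
have phiH f : H f -> K (phi f) by case: isophi => -[+ _ _] _ _ _ _; apply.
have psiH k : K k -> H (psi k) by case: isopsi => -[+ _ _] _ _ _ _; apply.
exists t, s; split=> // [y|z].
- apply: (separates Y H) => // f Hf; rewrite sP // tP ?psiK //; exact: phiH.
- apply: (separates Z K) => // k Kk; rewrite tP // sP ?phiK //; exact: psiH.
Qed.

End isometric_isomorphisms.

(** * Extending functions from a dense subspace *)

Lemma continuous_into_set_type (S T : topologicalType) (A : set T) (f : S -> A) :
  continuous ((\val : A -> T) \o f) -> continuous f.
Proof.
move=> /continuousP cf; apply/continuousP => U /open_set_typeP[V oV <-].
exact: cf V oV.
Qed.

Lemma dense_closure (T : topologicalType) (D O : set T) :
  dense D -> open O -> O `<=` closure (O `&` D).
Proof.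
move=> dD oO x Ox N; rewrite nbhsE => -[N' [oN' N'x] N'N].
have [|y [[N'y Oy] Dy]] := dD (N' `&` O) _ (openI oN' oO); first by exists x.
by exists y; split=> //; exact: N'N.
Qed.

Section dense_extension.
Variables (R : realType) (X Y : topologicalType) (i : X -> Y).
Hypotheses (ci : continuous i) (di : dense (range i)).

(** A value of |k| exceeding the norm of f would be exceeded on a nonempty open
set, which meets the dense range of i. *)
Lemma dense_sup_norm (k : Cb R Y) (f : Cb R X) : (forall x, k (i x) = f x) -> `|k| = `|f|.
Proof.
move=> kf; apply/eqP; rewrite eq_le; apply/andP; split; last first.
  by apply: sup_norm_le => [|x]; [exact: sup_norm_ge0|rewrite -kf; exact: sup_norm_ub].
apply: sup_norm_le => [|y]; first exact: sup_norm_ge0.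
rewrite leNgt; apply/negP => fk.
pose O := [set z | `|f| < `|k z|].
have oO : open O.
  rewrite (_ : O = (fun z => `|k z|) @^-1` [set r | `|f| < r]) //.
  by apply: open_comp => [z _|]; [exact: Cb_normr_continuous|exact: open_gt].
have [|z [Oz [x _ xz]]] := di _ oO; first by exists y.
by move: Oz; rewrite /O /mkset -xz kf ltNge sup_norm_ub.
Qed.

Lemma dense_Cb_ext (k l : Cb R Y) : (forall x, k (i x) = l (i x)) -> k = l.
Proof.
move=> kl; apply/eqP; rewrite -subr_eq0 -normr_eq0.
rewrite (@dense_sup_norm _ (0 : Cb R X)) ?normr0 // => x.
by rewrite !Cb_evalE kl subrr.
Qed.

(** The inverse of phi is the restriction along i, and continuous functions on Y
are determined by their restrictions; so phi inherits the algebra structure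
and the norm from restriction. *)
Lemma extension_algebra_isometry (phi : Cb R X -> Cb R Y)
    (H : set (Cb R X)) (K : set (Cb R Y)) :
  (forall f x, phi f (i x) = f x) -> (forall f, H f <-> K (phi f)) ->
  algebra_isometry H K phi.
Proof.
move=> phiE HK; split.
- split.
  + by move=> f /HK.
  + by move=> f g _ _ fg; apply: Cb_ext => x; rewrite -!phiE fg.
  + move=> k Kk; have [x||f fE] := @exists_Cb R X (k \o i) `|k|.
    * by apply: continuous_comp; [exact: ci|exact: Cb_continuous].
    * by move=> x; exact: sup_norm_ub.
    have fk : phi f = k by apply: dense_Cb_ext => x; rewrite phiE fE.
    by exists f => //; apply/HK; rewrite fk.
- by move=> f g _ _; apply: dense_Cb_ext => x; rewrite !Cb_evalE !phiE.
- by move=> a f _; apply: dense_Cb_ext => x; rewrite !Cb_evalE !phiE.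
- by move=> f g _ _; apply: dense_Cb_ext => x; rewrite !Cb_evalE !phiE.
- by move=> f g _ _; apply: dense_sup_norm => x; rewrite !Cb_evalE !phiE.
Qed.

End dense_extension.

(** * The Stone-Cech compactification *)

Section stone_cech_theory.
Variables (R : realType) (X bX : topologicalType) (e : X -> bX).
Hypothesis sc : stone_cech e.

Lemma stone_cech_continuous : continuous e.
Proof.
apply/continuousP => V oV; case: (stone_cech_embedding sc) => _ eU.
by apply/eU; exists V.
Qed.

(** The universal property is used with the compact interval from - |f| to
|f|. *)
Lemma stone_cech_extend (f : Cb R X) : exists g : Cb R bX, forall x, g (e x) = f x.
Proof.
pose I : set R := `[- `|f|, `|f|]%classic.
have fI x : I (f x).
  by have := sup_norm_ub f x; rewrite ler_norml /I /= in_itv.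
pose f' x : I := exist _ (f x) (mem_set (fI x)).
have cf' : continuous f'.
  by apply: continuous_into_set_type => x; exact: Cb_continuous.
have cI : compact [set: I].
  rewrite (_ : [set: I] = (\val : I -> R) @^-1` I); last first.
    by apply/seteqP; split=> // y _; exact: set_valP_mem.
  exact: compact_set_type_preimage (@segment_compact _ _ _).
have hI : hausdorff_space I by exact: hausdorff_set_type (@Rhausdorff R).
have [g cg gE] := stone_cech_extension sc cI hI cf'.
have [|z|G GE] := @exists_Cb R bX (\val \o g) `|f|.
- move=> z; apply: continuous_comp; [exact: cg|exact: val_continuous].
- have : I (\val (g z)) by exact: set_valP_mem.
  by rewrite /I /= in_itv /= -ler_norml.
exists G => x; rewrite GE /=.
by have -> : g (e x) = f' x by rewrite -gE.
Qed.

End stone_cech_theory.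

(** * The spectrum *)

Section null_spectrum_theory.
Variables (R : realType) (X : topologicalType).
Variables (B : set (set X)) (mu : set X -> \bar R).
Hypothesis Hmu : topological_measure B mu.
Variables (bX : topologicalType) (e : X -> bX).
Hypothesis sc : stone_cech e.

Let Y : set bX := null_spectrum B mu e.

Lemma open_null_spectrum : open Y.
Proof. by apply: bigcup_open => C _; exact: open_interior. Qed.

(** Let g be a bump function, 1 on A, with support in a null open set, and G its
extension to bX. Then G = 1 on the closure of A, and the open set coz G lies in
the closure of coz g by density of X; so coz g is the required cozero set. *)
Lemma closure_null_sub_spectrum (A : set X) : normal_space X -> closed A ->
  has_null_neighborhood B mu A -> closure (e @` A) `<=` Y.
Proof.
move=> nX cA /(has_null_neighborhoodP Hmu)[U [oU AU U0]].
have [|g [g1 gU]] := @separated_bump R X A U.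
  apply: (proj1 (@normal_separatorP R X) nX) => //; first exact: open_closedC.
  by apply/disjoints_subset; rewrite setCK.
have [G GE] := stone_cech_extend sc g.
have oG : open (coz G) by apply: open_coz; exact: Cb_continuous.
have G1 : closure (e @` A) `<=` coz G.
  have cG1 : closed (G @^-1` [set 1]).
    by apply: preimage_closed => //; move=> z _; exact: Cb_continuous.
  move=> z clz; have : (G @^-1` [set 1]) z.
    rewrite (proj1 (closure_id _) cG1); apply: closureS clz => _ [a Aa <-] /=.
    by rewrite GE g1.
  by rewrite /= => Gz; apply/cozE; rewrite Gz oner_neq0.
move=> z /G1 Gz; exists (coz g).
  split; first by exists g => //; exact: Cb_continuous.
  by apply/(has_null_neighborhoodP Hmu); exists U.
suff sub : coz G `<=` closure (e @` coz g).
  by apply: (interiorS sub); rewrite (proj1 (interior_id _) oG).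
apply: subset_trans (dense_closure (stone_cech_dense sc) oG) _.
by apply: closureS => w [/cozE + [x _ xz]]; rewrite -xz GE => /cozE gx; exists x.
Qed.

(** The sets defining the spectrum form a directed family, because the union of
two cozero sets is a cozero set; so K lies in the closure of one C in bX. As e
is an embedding, the trace of that closure on X is the closure of C in X. *)
Lemma preimage_compact_null (K : set bX) : compact K -> K `<=` Y ->
  has_null_neighborhood B mu (e @^-1` K).
Proof.
move=> cK KY.
pose G := [set (closure (e @` C))° | C in [set C : set X | cozero_sets R C /\
                   has_null_neighborhood B mu (closure C)]].
have [||||_ [C [_ nC] <-] KC] := @compact_directed_cover _ G K cK.
- exists (closure (e @` set0))°; exists set0 => //; split.
    by exists (0 : Cb R X); [exact: Cb_continuous|rewrite coz0].
  by rewrite closure0; exact: has_null_neighborhood0.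
- move=> _ _ [C [[f cf ->] nf] <-] [D [[g cg ->] ng] <-].
  exists (closure (e @` (coz f `|` coz g)))°; last first.
    by rewrite image_setU closureU; exact: interiorU.
  exists (coz f `|` coz g) => //; split; last first.
    by rewrite closureU; exact: has_null_neighborhoodU.
  exists (fun x => `|f x| + `|g x|).
    by move=> x; apply: cvgD; apply: cvg_norm; [exact: cf|exact: cg].
  apply/seteqP; split=> x.
    by move=> [/cozE|/cozE] fx; apply/cozE; rewrite paddr_eq0 // !normr_eq0 negb_and fx ?orbT.
  move=> /cozE; rewrite paddr_eq0 // !normr_eq0 negb_and.
  by move=> /orP[?|?]; [left|right]; apply/cozE.
- by move=> _ [C _ <-]; exact: open_interior.
- by move=> z /KY[C CP Cz]; exists (closure (e @` C))° => //; exists C.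
apply: has_null_neighborhoodS nC => x /KC/interior_subset clx N Nx.
have [_ eO] := stone_cech_embedding sc.
move: Nx; rewrite nbhsE => -[W [/eO[V oV <-] Vx] WN].
have [w [[c Cc cw] Vc]] := clx V (open_nbhs_nbhs (conj oV Vx)).
by exists c; split=> //; apply: WN; rewrite /= cw.
Qed.

Hypotheses (nX : normal_space X) (hX : hausdorff_space X) (lnull : locally_null B mu).

Lemma range_sub_null_spectrum x : Y (e x).
Proof.
apply: (@closure_null_sub_spectrum [set x]) => //.
  exact: accessible_closed_set1 (hausdorff_accessible hX) x.
by apply: subset_closure; exists x.
Qed.

Definition to_spectrum x : Y := exist _ (e x) (mem_set (range_sub_null_spectrum x)).

Lemma to_spectrum_continuous : continuous to_spectrum.
Proof. by apply: continuous_into_set_type; exact: stone_cech_continuous sc. Qed.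

Lemma range_to_spectrum : range to_spectrum = [set y : Y | range e (\val y)].
Proof.
apply/seteqP; split=> [_ [x _ <-]|y [x _ xy]]; first by exists x.
by exists x => //; exact: val_inj.
Qed.

Lemma dense_to_spectrum : dense (range to_spectrum).
Proof.
move=> O [y Oy] /open_set_typeP[V oV VO]; subst O.
have [|z [[Vx Yx] [x _ xE]]] := stone_cech_dense sc _ (openI oV open_null_spectrum).
  by exists (\val y); split=> //; exact: set_valP_mem.
by exists (to_spectrum x); split; [rewrite /= xE|exists x].
Qed.

(** The closure in Y is a closed subset of the trace of the closure in bX, which
is compact and lies in Y. *)
Lemma null_closure_compact (A : set X) : closed A ->
  has_null_neighborhood B mu A -> compact (closure (to_spectrum @` A)).
Proof.
move=> cA nA; have sub := closure_null_sub_spectrum nX cA nA.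
have cc : compact (closure (e @` A)).
  exact: subclosed_compact (@closed_closure _ _) (stone_cech_compact sc) _.
apply: (subclosed_compact (@closed_closure _ _) (compact_set_type_preimage sub cc)).
have clc : closed ((\val : Y -> bX) @^-1` closure (e @` A)).
  apply: preimage_closed; last exact: closed_closure.
  by move=> y _; exact: val_continuous.
rewrite [X in _ `<=` X](proj1 (closure_id _) clc); apply: closureS => _ [a Aa <-].
by apply: subset_closure; exists a.
Qed.

Lemma compact_preimage_null (S : set Y) : compact S ->
  has_null_neighborhood B mu (to_spectrum @^-1` S).
Proof.
move=> cS; pose K := (\val : Y -> bX) @` S.
apply: (@has_null_neighborhoodS _ _ _ _ _ (e @^-1` K)).
  by move=> x Sx; exists (to_spectrum x).
apply: preimage_compact_null.
  by apply: continuous_compact cS; apply: continuous_subspaceT; exact: val_continuous.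
by move=> _ [y _ <-]; exact: set_valP_mem.
Qed.

Lemma spectrum_extension (f : Cb R X) : exists k : Cb R Y, forall x, k (to_spectrum x) = f x.
Proof.
have [G GE] := stone_cech_extend sc f.
have [y|y|k kE] := @exists_Cb R Y (G \o \val) `|G|.
- by apply: continuous_comp; [exact: val_continuous|exact: Cb_continuous].
- exact: sup_norm_ub.
by exists k => x; rewrite kE /= GE.
Qed.

Section extension_pair.
Variables (f : Cb R X) (k : Cb R Y).
Hypothesis kf : forall x, k (to_spectrum x) = f x.

(** By density of X, the support of k is the closure in Y of the support of f,
and its trace on X contains the support of f. *)
Lemma M00_C00 : M00 B mu f <-> @C00 R Y k.
Proof.
split=> [nf|ck].
  apply: (subclosed_compact (@closed_closure _ _) (null_closure_compact (@closed_closure _ _) nf)).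
  rewrite [X in _ `<=` X](proj1 (closure_id _) (@closed_closure _ _)); apply: closureS.
  have ok : open (coz k) by apply: open_coz; exact: Cb_continuous.
  apply: subset_trans (dense_closure dense_to_spectrum ok) (closureS _).
  move=> z [/cozE + [x _ xz]]; rewrite -xz kf => /cozE fx.
  by exists x => //; exact: subset_closure.
apply: has_null_neighborhoodS (compact_preimage_null ck).
have cl : closed (to_spectrum @^-1` supp k).
  apply: preimage_closed; last exact: closed_closure.
  by move=> x _; exact: to_spectrum_continuous.
rewrite [X in _ `<=` X](proj1 (closure_id _) cl); apply: closureS => x /cozE fx.
by apply: subset_closure; apply/cozE; rewrite kf.
Qed.

(** If coz f is null, the set where |k| >= d lies in the closure of the set where
|f| >= d/2, which is closed in X and has the null neighborhood coz f. If
conversely k vanishes at infinity, coz f is the countable union of the traces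
of the compact sets where |k| >= 1/(n+1). *)
Lemma M0_C0 : M0 mu f <-> @C0 R Y k.
Proof.
split=> [nf|ck].
  apply/C0P => d d0; have d20 : 0 < d / 2 by rewrite divr_gt0.
  pose A := [set x | d / 2 <= `|f x|].
  have cA : closed A by exact: closed_superlevel (@Cb_normr_continuous R X f).
  have nA : has_null_neighborhood B mu A.
    apply/(has_null_neighborhoodP Hmu); exists (coz f); split => //.
      by apply: open_coz; exact: Cb_continuous.
    by move=> x fx; apply/cozE; rewrite -normr_gt0; exact: lt_le_trans fx.
  apply: (subclosed_compact _ (null_closure_compact cA nA)).
    exact: closed_superlevel (@Cb_normr_continuous R _ k).
  pose O := [set y | d / 2 < `|k y|].
  have oO : open O.
    rewrite (_ : O = (fun z => `|k z|) @^-1` [set r | d / 2 < r]) //.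
    by apply: open_comp => [z _|]; [exact: Cb_normr_continuous|exact: open_gt].
  have dO : [set y | d <= `|k y|] `<=` O.
    by move=> y; apply: lt_le_trans; rewrite ltr_pdivrMr // ltr_pMr // ltr1n.
  apply: subset_trans dO _.
  apply: subset_trans (dense_closure dense_to_spectrum oO) (closureS _).
  by move=> z [+ [x _ xz]]; rewrite -xz /O /mkset kf => fx; exists x => //; exact: ltW.
have /choice[U UP] (n : nat) : exists U, [/\ open U,
    [set x | n.+1%:R^-1 <= `|f x|] `<=` U & mu U = 0%E].
  have /(has_null_neighborhoodP Hmu)[U [oU kU U0]] := compact_preimage_null (ck n).
  by exists U; split=> // x fx; apply: kU; rewrite /= kf.
apply: (@null_cover _ _ _ _ Hmu _ U).
- by apply: (proj2 Hmu); apply: open_coz; exact: Cb_continuous.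
- by move=> n; have [oU _ U0] := UP n; split => //; apply: (proj2 Hmu).
- move=> x /cozE; rewrite -normr_gt0 => /ltr_add_invr[n]; rewrite add0r => nf.
  by exists n => //; have [_ + _] := UP n; apply; exact: ltW.
Qed.

End extension_pair.

Lemma null_spectrum_isomorphisms :
  isometrically_isomorphic (M00 B mu) (@C00 R Y) /\
  isometrically_isomorphic (M0 mu) (@C0 R Y).
Proof.
have /choice[phi phiE] := spectrum_extension.
have iso := extension_algebra_isometry to_spectrum_continuous dense_to_spectrum phiE.
split; exists phi; apply: iso => f.
- exact: M00_C00 (phiE f).
- exact: M0_C0 (phiE f).
Qed.

(** If X is null, it is a closed set with a null neighborhood, so its closure in
the spectrum, which is everything, is compact; conversely the trace on X of a
compact spectrum is X. *)
Lemma null_spectrum_compact : compact [set: Y] <-> trivial_measure mu.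
Proof.
split=> [/compact_preimage_null|triv].
  rewrite preimage_setT => /(has_null_neighborhoodP Hmu)[U [_ TU U0]].
  by rewrite /trivial_measure -U0; congr mu; apply/seteqP.
have := @null_closure_compact [set: X] closedT.
rewrite (_ : closure _ = setT); first apply.
  by apply/(has_null_neighborhoodP Hmu); exists [set: X]; split => //; exact: openT.
apply/seteqP; split=> // y _.
have := dense_closure dense_to_spectrum openT (I : setT y).
by rewrite setTI.
Qed.

End null_spectrum_theory.

(** * The theorem *)

Theorem theorem6p5 (R : realType) (X : topologicalType)
    (B : set (set X)) (mu : set X -> \bar R)
    (Hmu : topological_measure B mu) :
  (* (1) *)
  is_ideal (M00 B mu) /\
  (* (2) *)
  [/\ is_ideal (M0 mu), closed (M0 mu) & M00 B mu `<=` M0 mu] /\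
  (* (3) *)
  (hausdorff_space X -> completely_regular_space X ->
    (of_empty_hull (M00 B mu) <-> of_empty_hull (M0 mu)) /\
    (of_empty_hull (M0 mu) <-> locally_null B mu)) /\
  (* (4) *)
  (hausdorff_space X -> completely_regular_space X -> locally_null B mu ->
    (unital (M00 B mu) <-> unital (M0 mu)) /\
    (unital (M0 mu) <-> trivial_measure mu)) /\
  (* (5) *)
  (hausdorff_space X -> normal_space X -> locally_null B mu ->
    forall (bX : topologicalType) (e : X -> bX), stone_cech e ->
    let Y : set bX := null_spectrum B mu e in
    [/\ hausdorff_space Y /\ locally_compact [set: Y],
        isometrically_isomorphic (M00 B mu) (@C00 R Y) /\
        isometrically_isomorphic (M0 mu) (@C0 R Y),
        forall Y' : topologicalType,
          hausdorff_space Y' -> locally_compact [set: Y'] ->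
          isometrically_isomorphic (M00 B mu) (@C00 R Y') \/
          isometrically_isomorphic (M0 mu) (@C0 R Y') ->
          homeomorphic Y Y',
        range e `<=` Y /\ dense [set y : Y | range e (\val y)] &
        M0 mu `<=` closure (M00 B mu) /\
        ((unital (M00 B mu) <-> unital (M0 mu)) /\
         (unital (M0 mu) <-> compact [set: Y]))]).
Proof.
have M00M0 := M00_sub_M0 Hmu.
have equivalences : completely_regular_space X -> hausdorff_space X ->
    locally_null B mu ->
    (unital (M00 B mu) <-> trivial_measure mu) /\
    (unital (M0 mu) <-> trivial_measure mu).
  move=> crX hX lnull; have eM00 := locally_null_M00_empty_hull Hmu hX crX lnull.
  split; split.
  - exact: unital_trivial M00M0 eM00.
  - by apply: (trivial_unital Hmu).
  - by apply: unital_trivial => //; exact: of_empty_hullS eM00.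
  - by apply: (trivial_unital Hmu).
split; first exact: M00_ideal.
split; first by split => //; [exact: (M0_ideal Hmu)|exact: (M0_closed Hmu)].
split.
  move=> hX crX; have M0null := M0_empty_hull_locally_null Hmu.
  have nullM00 := locally_null_M00_empty_hull Hmu hX crX.
  have M00eM0 := of_empty_hullS M00M0.
  by split; split=> //; [move=> /M0null/nullM00|move=> /nullM00/M00eM0].
split.
  move=> hX crX lnull; have [u00 u0] := equivalences crX hX lnull.
  by split=> //; exact: (iff_trans u00 (iff_sym u0)).
move=> hX nX lnull bX e sc Y.
have crX : completely_regular_space X.
  exact: (@normal_completely_regular R) nX (hausdorff_accessible hX).
have [u00 u0] := equivalences crX hX lnull.
have hY : hausdorff_space Y by exact: hausdorff_set_type (stone_cech_hausdorff sc).
have lY : locally_compact [set: Y].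
  apply: locally_compact_open_subspace (open_null_spectrum _ _ _).
    exact: stone_cech_hausdorff sc.
  exact: stone_cech_compact sc.
have [iso00 iso0] := null_spectrum_isomorphisms Hmu sc nX hX lnull.
split=> //.
- move=> Y' hY' lY' [iso|iso].
  + apply: regular_ideal_isomorphism_homeomorphic hY hY' (C00_regular R hY lY)
      (C00_regular R hY' lY') _.
    apply: isometrically_isomorphic_trans iso.
    exact: isometrically_isomorphic_sym (M00_ideal Hmu) iso00.
  + apply: regular_ideal_isomorphism_homeomorphic hY hY' (C0_regular R hY lY)
      (C0_regular R hY' lY') _.
    apply: isometrically_isomorphic_trans iso.
    exact: isometrically_isomorphic_sym (M0_ideal Hmu) iso0.
- split; first by move=> _ [x _ <-]; exact: range_sub_null_spectrum.
  rewrite -(range_to_spectrum Hmu sc nX hX lnull); exact: dense_to_spectrum.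
- split; first exact: M0_sub_closure_M00.
  split; first exact: (iff_trans u00 (iff_sym u0)).
  exact: (iff_trans u0 (iff_sym (null_spectrum_compact Hmu sc nX hX lnull))).
Qed.
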